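(* For $n\ge0$, $$F_{n+1}=\sum_{k=0}^{n}\binom{n}{k}_{q_1,q_2}\,p_1^{k}p_2^{\,n-k}\,F_kF_{n-k}.$$ Moreover, $\displaystyle\Big(\frac{d}{dx}\Big)_{q_1,q_2}\mathcal{F}(x)=\mathcal{F}(p_1x)\,\mathcal{F}(p_2x)$.
   Context: For $\pi\in\mathfrak{S}_n$ define the statistics: $S_1(\pi)$ = number of pairs of positions $i<j$ with $\pi(i)<\pi(j)$ and no $l$ with $i<l<j$ and $\pi(l)>\pi(j)$; $S_2(\pi)$ = number of pairs $i<j$ with $\pi(i)>\pi(j)$ and no $l$ with $i<l<j$ and $\pi(l)>\pi(i)$; $T_1(\pi)$ = number of triples $i<j<k$ with $\pi(i)<\pi(k)<\pi(j)$ and no $l$ with $i<l<k$, $l\ne j$, $\pi(l)>\pi(j)$; $T_2(\pi)$ = number of triples $i<j<k$ with $\pi(k)<\pi(i)<\pi(j)$ and no $l$ with $i<l<k$, $l\ne j$, $\pi(l)>\pi(j)$. (These are the mesh patterns $(12,\{(1,2)\})$, $(21,\{(1,2)\})$, $(132,\{(1,3),(2,3)\})$, $(231,\{(1,3),(2,3)\})$.) Let $F_n=\sum_{\pi\in\mathfrak{S}_n}p_1^{S_1(\pi)}p_2^{S_2(\pi)}q_1^{T_1(\pi)}q_2^{T_2(\pi)}$ (so $F_0=1$). Let $[m]=q_1^{m-1}+q_1^{m-2}q_2+\cdots+q_2^{m-1}$ for $m\ge1$, $[m]!=[1][2]\cdots[m]$ with $[0]!=1$, and $\binom{n}{k}_{q_1,q_2}=[n]!/([k]![n-k]!)$.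 Let $\mathcal{F}(x)=\sum_{n\ge0}F_nx^n/[n]!$, and define the $q_1,q_2$-derivative by $\big(\frac{d}{dx}\big)_{q_1,q_2}f(x)=\frac{f(q_1x)-f(q_2x)}{q_1x-q_2x}$. *)

(* Defs.v *)
From HB Require Import structures.
From mathcomp Require Import all_boot all_order all_fingroup all_algebra.
From mathcomp Require Import boolp classical_sets mpoly.

Set Implicit Arguments.
Unset Strict Implicit.
Unset Printing Implicit Defensive.

Import GRing.Theory Num.Theory.
Local Open Scope ring_scope.

(** * Mesh pattern statistics *)

(* 'S_n is {perm 'I_n}: positions and values are 0, ..., n-1, and 'S_0 has one
   element.  Only relative orders are used, so the shift is harmless. *)

Section Statistics.
Variables (n : nat) (s : 'S_n).

(* mesh pattern (12, {(1,2)}) *)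
Definition S1 : nat :=
  #|[set t : 'I_n * 'I_n | let: (i, j) := t in
      [&& (i < j)%N, (s i < s j)%N
        & ~~ [exists l : 'I_n, (i < l < j)%N && (s j < s l)%N]]]|.

(* mesh pattern (21, {(1,2)}) *)
Definition S2 : nat :=
  #|[set t : 'I_n * 'I_n | let: (i, j) := t in
      [&& (i < j)%N, (s j < s i)%N
        & ~~ [exists l : 'I_n, (i < l < j)%N && (s i < s l)%N]]]|.

(* mesh pattern (132, {(1,3),(2,3)}) *)
Definition T1 : nat :=
  #|[set t : 'I_n * 'I_n * 'I_n | let: (i, j, k) := t in
      [&& (i < j < k)%N, (s i < s k < s j)%N
        & ~~ [exists l : 'I_n, [&& (i < l < k)%N, l != j & (s j < s l)%N]]]]|.

(* mesh pattern (231, {(1,3),(2,3)}) *)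
Definition T2 : nat :=
  #|[set t : 'I_n * 'I_n * 'I_n | let: (i, j, k) := t in
      [&& (i < j < k)%N, (s k < s i < s j)%N
        & ~~ [exists l : 'I_n, [&& (i < l < k)%N, l != j & (s j < s l)%N]]]]|.

End Statistics.

(* F_n *)
Definition meshF (R : comNzRingType) (p1 p2 q1 q2 : R) (n : nat) : R :=
  \sum_(s : 'S_n) p1 ^+ S1 s * p2 ^+ S2 s * q1 ^+ T1 s * q2 ^+ T2 s.

(** * Two-parameter q-analogues *)

Definition qint (R : comNzRingType) (q1 q2 : R) (m : nat) : R :=
  \sum_(i < m) q1 ^+ (m.-1 - i) * q2 ^+ i.

Definition qfact (R : comNzRingType) (q1 q2 : R) (n : nat) : R :=
  \prod_(1 <= m < n.+1) qint q1 q2 m.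

Definition qbinom (K : fieldType) (q1 q2 : K) (n k : nat) : K :=
  qfact q1 q2 n / (qfact q1 q2 k * qfact q1 q2 (n - k)).

(** * Formal power series *)

(* [f n] is the coefficient of x^n. *)
Definition fps (K : fieldType) := nat -> K.

Section PowerSeries.
Variable K : fieldType.
Implicit Types (a : K) (f g h : fps K).

(* a x *)
Definition fps_cX a : fps K := fun n => if n == 1%N then a else 0.

Definition fps_sub f g : fps K := fun n => f n - g n.

Definition fps_mul f g : fps K := fun n => \sum_(i < n.+1) f i * g (n - i)%N.

(* f(a x) *)
Definition fps_dilate a f : fps K := fun n => a ^+ n * f n.

(* The quotient f / g: the series h with g h = f.  It is unique when g is
   nonzero, since K[[x]] is a domain; a junk value if there is none. *)
Definition fps_quot f g : fps K :=
  xget ((fun=> 0) : nat -> K) [set h : nat -> K | fps_mul g h = f].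

(* (f(q1 x) - f(q2 x)) / (q1 x - q2 x) *)
Definition qderiv (q1 q2 : K) f : fps K :=
  fps_quot (fps_sub (fps_dilate q1 f) (fps_dilate q2 f))
           (fps_sub (fps_cX q1) (fps_cX q2)).

(* The quotient in [qderiv] exists and is unique as soon as q1 != q2. *)
Lemma qderivP (q1 q2 : K) f h : q1 != q2 ->
  fps_mul (fps_sub (fps_cX q1) (fps_cX q2)) h
    = fps_sub (fps_dilate q1 f) (fps_dilate q2 f) <-> h = qderiv q1 q2 f.
Proof.
move=> q12; have d0 : q1 - q2 != 0 by rewrite subr_eq0.
set D := fps_sub (fps_cX _) _; set N := fps_sub _ _.
have mulD0 g : fps_mul D g 0%N = 0.
  by rewrite /fps_mul big_ord1 /D /fps_sub /fps_cX /= subr0 mul0r.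
have mulDS g n : fps_mul D g n.+1 = (q1 - q2) * g n.
  rewrite /fps_mul 2!big_ord_recl big1 => [|i _].
    by rewrite /D /fps_sub /fps_cX /= subr0 mul0r add0r addr0 /bump /= subSS subn0.
  by rewrite /D /fps_sub /fps_cX /= subr0 mul0r.
have ex : fps_mul D (fun n => N n.+1 / (q1 - q2)) = N.
  apply/funext => -[|n]; last by rewrite mulDS mulrC divfK.
  by rewrite mulD0 /N /fps_sub /fps_dilate !expr0 subrr.
have spec : fps_mul D (qderiv q1 q2 f) = N.
  exact: (@xgetI _ _ [set g : nat -> K | fps_mul D g = N] _ ex).
split=> [hN|->//]; apply/funext => n; apply: (mulfI d0).
by rewrite -!mulDS hN spec.
Qed.

End PowerSeries.

(* The series F(x) = \sum_n F_n x^n / [n]! *)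
Definition meshFseries (K : fieldType) (p1 p2 q1 q2 : K) : fps K :=
  fun n => meshF p1 p2 q1 q2 n / qfact q1 q2 n.

(** * The generic case *)

(* The theorem is stated for parameters in a field such that the divisions
   make sense; this covers independent indeterminates p1, p2, q1, q2, in the
   field of fractions of Z[p1, p2, q1, q2]. *)

Definition indet (i : 'I_4) : {fraction {mpoly int[4]}} := tofrac 'X_i.

Lemma qint_indet_neq0 (i j : 'I_4) (m : nat) :
  (0 < m)%N -> qint (indet i) (indet j) m != 0.
Proof.
move=> m_gt0.
have -> : qint (indet i) (indet j) m = tofrac (qint ('X_i : {mpoly int[4]}) 'X_j m).
  by rewrite /qint rmorph_sum; apply: eq_bigr => k _; rewrite rmorphM !rmorphXn.
rewrite tofrac_eq0; apply/eqP => /(congr1 (meval (fun=> 1))).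
rewrite meval0 /qint raddf_sum /=.
under eq_bigr => k _ do rewrite mevalM !rmorphXn /= !mevalXU !expr1n mulr1.
rewrite sumr_const card_ord => /eqP; rewrite pnatr_eq0.
by case: m m_gt0.
Qed.

Lemma indet_inj : injective indet.
Proof.
move=> i j /eqP; rewrite /indet tofrac_eq => /eqP.
move=> /(congr1 (meval (fun k => (k == i)%:R))); rewrite !mevalXU eqxx.
by case: eqP => [->|].
Qed.

(* Main.v *)
(* Write a permutation as [u ++ m :: v] with [m] its maximum.  An occurrence of
   a pattern that lies neither in [u] nor in [v] must use [m] as its largest
   entry, so S1 and S2 gain |u| and |v|, while T1 and T2 gain the numbers of
   non-inversions and of inversions between [u] and [v].  Summed over the ways to distribute the
   values between [u] and [v], the weight q1^noninv q2^inv is the Gaussian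
   binomial coefficient, by Pascal's rule.  Words over an arbitrary set of
   letters are summed, so that the two sides need no standardization: the
   recurrence itself shows that only the number of letters matters.  The
   functional equation is the recurrence read coefficientwise. *)

Require Import Defs.
From mathcomp Require Import all_boot all_order all_fingroup all_algebra.
From mathcomp Require Import boolp.
From mathcomp Require Import zify ring.

Import GRing.Theory.
Local Open Scope ring_scope.

(** * The four statistics on words of natural numbers *)

Section WordStatistics.
Local Open Scope nat_scope.
Implicit Types (t u v : seq nat) (i j k l m n r h : nat).

(** The shading condition shared by the four patterns; each instance takes [h] to be the largest
    entry of the occurrence. *)
Definition below_between t i j h :=
  [forall l : 'I_j, (i < l) ==> (nth 0 t l <= h)].

Definition occ12 t i j :=
  [&& i < j, nth 0 t i < nth 0 t j & below_between t i j (nth 0 t j)].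
Definition occ21 t i j :=
  [&& i < j, nth 0 t j < nth 0 t i & below_between t i j (nth 0 t i)].
(* The position [l = j], which the mesh excludes, satisfies
   [nth 0 t l <= nth 0 t j] trivially. *)
Definition occ132 t i j k :=
  [&& i < j < k, nth 0 t i < nth 0 t k < nth 0 t j
    & below_between t i k (nth 0 t j)].
Definition occ231 t i j k :=
  [&& i < j < k, nth 0 t k < nth 0 t i < nth 0 t j
    & below_between t i k (nth 0 t j)].

Definition count_pairs (Q : nat -> nat -> bool) n :=
  \sum_(i < n) \sum_(j < n) Q i j.
Definition count_triples (Q : nat -> nat -> nat -> bool) n :=
  \sum_(i < n) \sum_(j < n) \sum_(k < n) Q i j k.

Definition word_S1 t := count_pairs (occ12 t) (size t).
Definition word_S2 t := count_pairs (occ21 t) (size t).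
Definition word_T1 t := count_triples (occ132 t) (size t).
Definition word_T2 t := count_triples (occ231 t) (size t).

(** Non-inversions between [u] and [v] when [u] comes first; the inversions are then counted by
    [ncross_lt v u]. *)
Definition ncross_lt u v := \sum_(x <- u) \sum_(y <- v) (x < y).

Lemma below_betweenP t i j h :
  reflect (forall l, i < l < j -> nth 0 t l <= h) (below_between t i j h).
Proof.
apply: (iffP forallP) => [H l /andP[il lj]|H l].
  by have /implyP := H (Ordinal lj); apply.
by apply/implyP => il; apply: H; rewrite il ltn_ord.
Qed.

Lemma below_between_catl u v i j h : j <= size u ->
  below_between (u ++ v) i j h = below_between u i j h.
Proof.
by move=> ju; apply: eq_forallb => l; rewrite nth_cat (leq_trans (ltn_ord l) ju).
Qed.

Lemma nth_cat_addl u v i : nth 0 (u ++ v) (size u + i) = nth 0 v i.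
Proof. by rewrite nth_cat ltnNge leq_addr addKn. Qed.

Lemma below_between_catr u v i j h :
  below_between (u ++ v) (size u + i) (size u + j) h = below_between v i j h.
Proof.
apply/below_betweenP/below_betweenP => H l lij.
  by rewrite -(nth_cat_addl u); apply: H; lia.
have -> : l = size u + (l - size u) by lia.
by rewrite nth_cat_addl; apply: H; lia.
Qed.

Lemma sum_ord_cat_cons k r (f : nat -> nat) :
  \sum_(i < k + r.+1) f i
    = \sum_(i < k) f i + f k + \sum_(i < r) f (k.+1 + i).
Proof.
rewrite big_split_ord big_ord_recl /= addn0 -addnA; congr (_ + (_ + _)).
by apply: eq_bigr => i _; rewrite /bump /= addnA addn1.
Qed.

Lemma sum_ord_eq0 n (f : nat -> nat) :
  (forall i, i < n -> f i = 0) -> \sum_(i < n) f i = 0.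
Proof. by move=> f0; rewrite big1 // => i _; apply: f0. Qed.

(** Here [k] will be the position of the maximum. Once decreasing pairs and pairs straddling [k]
    vanish, a pair lies on one side of [k], ends at [k], or starts at [k]. *)
Lemma count_pairs_split (Q : nat -> nat -> bool) k r :
  (forall i j, Q i j -> i < j) ->
  (forall i j, i < k -> k < j -> Q i j = false) ->
  count_pairs Q (k + r.+1)
    = count_pairs Q k + \sum_(i < k) Q i k + \sum_(j < r) Q k (k.+1 + j)
      + count_pairs (fun i j => Q (k.+1 + i) (k.+1 + j)) r.
Proof.
move=> Qlt Qk.
have Q0 i j : j <= i -> Q i j = false.
  by move=> ji; apply/negP => /Qlt; rewrite ltnNge ji.
rewrite /count_pairs (sum_ord_cat_cons k r (fun i => \sum_(j < _) Q i j)).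
rewrite (sum_ord_cat_cons k r (fun j => nat_of_bool (Q k j))) (Q0 k k) //.
rewrite (sum_ord_eq0 k (fun j => nat_of_bool (Q k j))); last first.
  by move=> j jk; rewrite Q0 // ltnW.
rewrite !add0n -!big_split /=; congr (_ + _ + _).
  apply: eq_bigr => i _; rewrite (sum_ord_cat_cons k r (fun j => nat_of_bool (Q i j))).
  rewrite (sum_ord_eq0 r (fun j => nat_of_bool (Q i (k.+1 + j)))) ?addn0 //.
  by move=> j _; rewrite Qk //; lia.
apply: eq_bigr => i _.
rewrite (sum_ord_cat_cons k r (fun j => nat_of_bool (Q (k.+1 + i) j))).
rewrite Q0 ?addn0; last by lia.
rewrite (sum_ord_eq0 k (fun j => nat_of_bool (Q (k.+1 + i) j))) // => j jk.
by rewrite Q0 //; lia.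
Qed.

(** A triple whose span contains [k] survives only with its middle at [k]; every other triple lies
    on one side. *)
Lemma count_triples_split (Q : nat -> nat -> nat -> bool) k r :
  (forall i j l, Q i j l -> i < j < l) ->
  (forall i j l, i <= k <= l -> j != k -> Q i j l = false) ->
  count_triples Q (k + r.+1)
    = count_triples Q k + \sum_(i < k) \sum_(l < r) Q i k (k.+1 + l)
      + count_triples (fun i j l => Q (k.+1 + i) (k.+1 + j) (k.+1 + l)) r.
Proof.
move=> Qlt Qk.
have Q0 i j l : ~~ (i < j < l) -> Q i j l = false.
  by move=> N; apply/negP => /Qlt; apply/negP.
rewrite /count_triples.
rewrite (sum_ord_cat_cons k r (fun i => \sum_(j < _) \sum_(l < _) Q i j l)).
have -> : \sum_(j < k + r.+1) \sum_(l < k + r.+1) Q k j l = 0.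
  rewrite big1 // => j _; rewrite big1 // => l _.
  case: (boolP (k < j < l)) => [kjl|/Q0 -> //]; rewrite Qk //; lia.
rewrite addn0 -!big_split /=; congr (_ + _); apply: eq_bigr => i _.
  rewrite (sum_ord_cat_cons k r (fun j => \sum_(l < _) Q i j l)) -addnA.
  have -> : \sum_(j < r) \sum_(l < k + r.+1) Q i (k.+1 + j) l = 0.
    rewrite big1 // => j _; rewrite big1 // => l _.
    case: (boolP (i < k.+1 + j < l)) => [kjl|/Q0 -> //].
    by rewrite Qk //; have := ltn_ord i; lia.
  rewrite addn0; congr (_ + _).
    apply: eq_bigr => j _.
    rewrite (sum_ord_cat_cons k r (fun l => nat_of_bool (Q i j l))).
    rewrite Qk ?addn0; try (have := ltn_ord i; have := ltn_ord j; lia).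
    rewrite (sum_ord_eq0 r (fun l => nat_of_bool (Q i j (k.+1 + l)))) ?addn0 // => l _.
    by rewrite Qk //; have := ltn_ord i; have := ltn_ord j; lia.
  rewrite (sum_ord_cat_cons k r (fun l => nat_of_bool (Q i k l))).
  rewrite Q0 ?addn0; last by lia.
  by rewrite (sum_ord_eq0 k (fun l => nat_of_bool (Q i k l))) // => l lk; rewrite Q0 //; lia.
rewrite (sum_ord_cat_cons k r (fun j => \sum_(l < _) Q (k.+1 + i) j l)).
have -> : \sum_(j < k) \sum_(l < k + r.+1) Q (k.+1 + i) j l = 0.
  by rewrite big1 // => j _; rewrite big1 // => l _; rewrite Q0 //; have := ltn_ord j; lia.
have -> : \sum_(l < k + r.+1) Q (k.+1 + i) k l = 0.
  by rewrite big1 // => l _; rewrite Q0 //; lia.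
rewrite !add0n; apply: eq_bigr => j _.
rewrite (sum_ord_cat_cons k r (fun l => nat_of_bool (Q (k.+1 + i) (k.+1 + j) l))).
rewrite Q0 ?addn0; last by lia.
rewrite (sum_ord_eq0 k (fun l => nat_of_bool (Q (k.+1 + i) (k.+1 + j) l))) // => l lk.
by rewrite Q0 //; lia.
Qed.

Lemma eq_count_pairs (Q Q' : nat -> nat -> bool) n :
  (forall i j, i < n -> j < n -> Q i j = Q' i j) ->
  count_pairs Q n = count_pairs Q' n.
Proof. by move=> QQ'; do 2!apply: eq_bigr => ? _; rewrite QQ'. Qed.

Lemma eq_count_triples (Q Q' : nat -> nat -> nat -> bool) n :
  (forall i j k, i < n -> j < n -> k < n -> Q i j k = Q' i j k) ->
  count_triples Q n = count_triples Q' n.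
Proof. by move=> QQ'; do 3!apply: eq_bigr => ? _; rewrite QQ'. Qed.

(** * Cutting a word at its maximum *)

Section MaxDecomposition.
Variables (u v : seq nat) (m : nat).
Hypotheses (ltu : forall x, x \in u -> x < m) (ltv : forall x, x \in v -> x < m).
Local Notation t := (u ++ m :: v).
Local Notation k := (size u).

Let nthl i : i < k -> nth 0 t i = nth 0 u i.
Proof. by move=> ik; rewrite nth_cat ik. Qed.

Let nthm : nth 0 t k = m.
Proof. by rewrite nth_cat ltnn subnn. Qed.

Let nthr i : nth 0 t (k.+1 + i) = nth 0 v i.
Proof. by rewrite nth_cat ifF ?addSn ?subSn ?leq_addr ?addKn //; lia. Qed.

Let lt_nthl i : i < k -> nth 0 u i < m.
Proof. by move=> ik; apply/ltu/mem_nth. Qed.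

Let lt_nthr i : i < size v -> nth 0 v i < m.
Proof. by move=> ik; apply/ltv/mem_nth. Qed.

Let nth_le i : nth 0 t i <= m.
Proof.
(* Positions past the end read the default 0, which is at most [m]. *)
case: (ltnP i (size t)) => [it|/(nth_default 0) -> //].
have : nth 0 t i \in t by apply: mem_nth.
by rewrite mem_cat in_cons => /or3P[/ltu|/eqP->|/ltv] //; apply: ltnW.
Qed.

Let ltm_nth i : (m < nth 0 t i) = false.
Proof. by rewrite ltnNge nth_le. Qed.

Let bb_m i j : below_between t i j m.
Proof. by apply/below_betweenP => l _. Qed.

Let bb_across i j h : i < k < j -> h < m -> below_between t i j h = false.
Proof. by move=> ikj hm; apply/below_betweenP => /(_ k ikj); rewrite nthm leqNgt hm. Qed.

Let bb_left i j h : j < k -> below_between t i j h = below_between u i j h.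
Proof. by move=> jk; rewrite below_between_catl // ltnW. Qed.

Let bb_right i j h :
  below_between t (k.+1 + i) (k.+1 + j) h = below_between v i j h.
Proof.
(* The word is also [rcons u m ++ v], whose first part has length [k.+1]. *)
have := below_between_catr (rcons u m) v i j h.
by rewrite size_rcons cat_rcons.
Qed.

Let occ12_lt i j : occ12 t i j -> i < j. Proof. by case/and3P. Qed.
Let occ21_lt i j : occ21 t i j -> i < j. Proof. by case/and3P. Qed.
Let occ132_lt i j l : occ132 t i j l -> i < j < l. Proof. by case/and3P. Qed.
Let occ231_lt i j l : occ231 t i j l -> i < j < l. Proof. by case/and3P. Qed.

Let lt_nth_neq i : i < size t -> i != k -> nth 0 t i < m.
Proof.
move=> it; case: (ltngtP i k) => // [ik|ki] _; first by rewrite nthl ?lt_nthl.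
have e : i = k.+1 + (i - k.+1) by lia.
by rewrite e nthr; apply: lt_nthr; move: it; rewrite size_cat /=; lia.
Qed.

(** The maximum blocks every pair straddling it, is never the smaller entry, and completes an
    occurrence with each of the [k] entries before it. *)
Lemma word_S1_max : word_S1 t = word_S1 u + word_S1 v + k.
Proof.
rewrite /word_S1 size_cat /= count_pairs_split //; last first.
  move=> i j ik kj; apply/and3P => -[_ _].
  case: (ltnP j (size t)) => jt.
    by rewrite bb_across ?ik //; apply: lt_nth_neq; lia.
  (* The splitting lemma asks for every [j]; past the end the bound is the default 0, below [m]
     because an entry of [u] is. *)
  by rewrite (nth_default _ jt) bb_across ?ik // (leq_ltn_trans _ (lt_nthl i ik)).
rewrite [X in _ + X + _ + _](_ : _ = k); last first.
  transitivity (\sum_(i < k) 1); last by rewrite sum1_card card_ord.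
  by apply: eq_bigr => i _; rewrite /occ12 nthm nthl // ltn_ord lt_nthl // bb_m.
rewrite [X in _ + _ + X + _](_ : _ = 0); last first.
  by rewrite big1 // => j _; rewrite /occ12 nthm ltm_nth andbF.
rewrite addn0 addnAC; congr (_ + _ + _); apply: eq_count_pairs => i j ik jk.
  by rewrite /occ12 !nthl // bb_left.
by rewrite /occ12 !nthr bb_right ltn_add2l.
Qed.

(** Mirror image of the previous count: the maximum now starts an occurrence with each entry after
    it. *)
Lemma word_S2_max : word_S2 t = word_S2 u + word_S2 v + size v.
Proof.
rewrite /word_S2 size_cat /= count_pairs_split //; last first.
  by move=> i j ik kj; rewrite /occ21 (nthl _ ik) bb_across ?ik ?lt_nthl ?andbF.
rewrite [X in _ + X + _ + _](_ : _ = 0); last first.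
  by rewrite big1 // => j _; rewrite /occ21 nthm ltm_nth andbF.
rewrite [X in _ + _ + X + _](_ : _ = size v); last first.
  transitivity (\sum_(i < size v) 1); last by rewrite sum1_card card_ord.
  apply: eq_bigr => i _; rewrite /occ21 nthm nthr lt_nthr // bb_m.
  by rewrite ltnS leq_addr.
rewrite addn0 addnAC; congr (_ + _ + _); apply: eq_count_pairs => i j ik jk.
  by rewrite /occ21 !nthl // bb_left.
by rewrite /occ21 !nthr bb_right ltn_add2l.
Qed.

(** In 132 and 231 the middle entry is the largest. If it is not at [k], neither outer entry can be
    [m], so [m] lies strictly between them and violates the shading. *)
Let not_across i j l : i <= k <= l -> j != k -> nth 0 t i < nth 0 t j ->
  nth 0 t l < nth 0 t j -> below_between t i l (nth 0 t j) = false.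
Proof.
move=> /andP[ik kl] jk tij tlj.
have jm : nth 0 t j < m.
  case: (ltnP j (size t)) => [jt|/(nth_default 0) e]; first exact: lt_nth_neq.
  by rewrite e in tij.
have ik' : i != k by apply: contraTneq tij => ->; rewrite nthm ltm_nth.
have lk' : l != k by apply: contraTneq tlj => ->; rewrite nthm ltm_nth.
by apply: bb_across => //; lia.
Qed.

Let ncross_ltE :
  \sum_(i < k) \sum_(l < size v) (nth 0 u i < nth 0 v l) = ncross_lt u v.
Proof.
rewrite /ncross_lt (big_nth 0) big_mkord; apply: eq_bigr => i _.
by rewrite (big_nth 0) big_mkord.
Qed.

Let ncross_gtE :
  \sum_(i < k) \sum_(l < size v) (nth 0 v l < nth 0 u i) = ncross_lt v u.
Proof.
rewrite /ncross_lt exchange_big (big_nth 0) big_mkord; apply: eq_bigr => i _.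
by rewrite (big_nth 0) big_mkord.
Qed.

(** With the maximum in the middle the shading condition is automatic, so the new occurrences are
    exactly the non-inversions between [u] and [v]. *)
Lemma word_T1_max : word_T1 t = word_T1 u + word_T1 v + ncross_lt u v.
Proof.
rewrite /word_T1 size_cat /= count_triples_split //; last first.
  move=> i j l ikl jk; apply/and3P => -[_ /andP[il lj]].
  by rewrite not_across // (ltn_trans il).
rewrite -ncross_ltE addnAC; congr (_ + _ + _).
- apply: eq_count_triples => i j l ik jk lk.
  by rewrite /occ132 !nthl // bb_left.
- apply: eq_count_triples => i j l ik jk lk.
  by rewrite /occ132 !nthr bb_right !ltn_add2l.
- apply: eq_bigr => i _; apply: eq_bigr => l _.
  rewrite /occ132 nthm nthr nthl // ltn_ord lt_nthr // bb_m ltnS leq_addr.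
  by rewrite !andbT.
Qed.

Lemma word_T2_max : word_T2 t = word_T2 u + word_T2 v + ncross_lt v u.
Proof.
rewrite /word_T2 size_cat /= count_triples_split //; last first.
  move=> i j l ikl jk; apply/and3P => -[_ /andP[il lj]].
  by rewrite not_across // (ltn_trans il).
rewrite -ncross_gtE addnAC; congr (_ + _ + _).
- apply: eq_count_triples => i j l ik jk lk.
  by rewrite /occ231 !nthl // bb_left.
- apply: eq_count_triples => i j l ik jk lk.
  by rewrite /occ231 !nthr bb_right !ltn_add2l.
- apply: eq_bigr => i _; apply: eq_bigr => l _.
  rewrite /occ231 nthm nthr nthl // ltn_ord lt_nthl // bb_m ltnS leq_addr.
  by rewrite !andbT.
Qed.

End MaxDecomposition.

(** * Distributing letters between two words *)

Lemma ncross_lt_perm u u' v v' :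
  perm_eq u u' -> perm_eq v v' -> ncross_lt u v = ncross_lt u' v'.
Proof.
move=> uu' vv'; rewrite /ncross_lt (perm_big _ uu').
by apply: eq_bigr => x _; rewrite (perm_big _ vv').
Qed.

Lemma ncross_lt_consl x u v : all (gtn x) v -> ncross_lt (x :: u) v = ncross_lt u v.
Proof.
move=> /allP vx; rewrite /ncross_lt big_cons big_seq big1 // => y /vx /= yx.
by rewrite ltnNge ltnW.
Qed.

Lemma ncross_lt_consr x u v :
  all (gtn x) v -> ncross_lt v (x :: u) = size v + ncross_lt v u.
Proof.
move=> /allP vx; rewrite /ncross_lt -sum1_size -big_split /=.
by apply: eq_big_seq => y /vx /= yx; rewrite big_cons yx.
Qed.

(** Both parts keep the order of [s], so sortedness is inherited, and the recursion on the first
    letter has the shape of Pascal's rule. *)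
Fixpoint splits (s : seq nat) : seq (seq nat * seq nat) :=
  if s is x :: s' then
    [seq (x :: p.1, p.2) | p <- splits s'] ++ [seq (p.1, x :: p.2) | p <- splits s']
  else [:: ([::], [::])].

Lemma splits_perm p s : p \in splits s -> perm_eq (p.1 ++ p.2) s.
Proof.
elim: s p => [|x s IH] p /=; first by rewrite inE => /eqP->.
rewrite mem_cat => /orP[] /mapP[q /IH qs ->] /=; first by rewrite perm_cons.
by rewrite perm_catC /= perm_cons perm_catC.
Qed.

Lemma splits_subseq p s : p \in splits s -> subseq p.1 s /\ subseq p.2 s.
Proof.
elim: s p => [|x s IH] p /=; first by rewrite inE => /eqP->.
have sx v : subseq v s -> subseq v (x :: s).
  by move=> vs; apply: subseq_trans vs _; apply: subseq_cons.
rewrite mem_cat => /orP[] /mapP[q /IH [q1s q2s] ->] /=; rewrite eqxx.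
  by split=> //; apply: sx.
by split=> //; apply: sx.
Qed.

Lemma mem_splits_filter (a : pred nat) s :
  (filter a s, filter (predC a) s) \in splits s.
Proof.
elim: s => //= x s IH; rewrite mem_cat.
by case: (a x) => /=; apply/orP; [left|right]; apply/mapP;
  exists (filter a s, filter (predC a) s).
Qed.

(** When letters are distinct, the letter set of the first part determines the split. *)
Lemma splits_filterE p s : uniq s -> p \in splits s ->
  p = (filter (mem p.1) s, filter (predC (mem p.1)) s).
Proof.
elim: s p => [|x s IH] p /=; first by rewrite inE => _ /eqP->.
move=> /andP[xs us]; rewrite mem_cat => /orP[] /mapP[q qs ->] /=;
  have [e1 e2] : q.1 = filter (mem q.1) s /\ q.2 = filter (predC (mem q.1)) s
    by split; rewrite {1}(IH q us qs).
  have e y : y \in s -> (y \in x :: q.1) = (y \in q.1).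
    by move=> ys; rewrite in_cons; case: eqP => // yx; rewrite -yx ys in xs.
  rewrite in_cons eqxx /= {1}e1 {1}e2; congr (_ :: _, _);
    by apply: eq_in_filter => y ys /=; rewrite e.
have xq : x \in q.1 = false.
  apply: contraNF xs => xq; rewrite -(perm_mem (splits_perm _ _ qs)).
  by rewrite mem_cat xq.
by rewrite xq /= {1}e1 {1}e2.
Qed.

Lemma splits_uniq s : uniq s -> uniq (splits s).
Proof.
elim: s => //= x s IH /andP[xs /IH us]; rewrite cat_uniq !map_inj_uniq ?us /=.
- rewrite andbT; apply/hasPn => p /mapP[q qs ->]; apply/negP => /mapP[r _ [qr _]].
  case/negP: xs; rewrite -(perm_mem (splits_perm _ _ qs)) mem_cat qr.
  by rewrite mem_head.
- by move=> [a b] [c d] /= [-> ->].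
- by move=> [a b] [c d] /= [-> ->].
Qed.

Lemma cat_cons_inj m u v u' v' : m \notin u -> m \notin u' ->
  u ++ m :: v = u' ++ m :: v' -> u = u' /\ v = v'.
Proof.
elim: u u' => [|x u IH] [|y u'] //=.
- by move=> _ _ [->].
- by rewrite in_cons negb_or => _ /andP[/eqP ne _] [e _]; case: ne.
- by rewrite in_cons negb_or => /andP[/eqP ne _] _ [e _]; case: ne.
rewrite !in_cons !negb_or => /andP[_ mu] /andP[_ mu'] [-> e].
by have [-> ->] := IH _ mu mu' e.
Qed.

(** A permutation is cut uniquely at [m]; its two sides are arbitrary arrangements of the parts of
    one split. Both lists are duplicate-free, so equality of members suffices. *)
Lemma permutations_cons m s : uniq (m :: s) ->
  perm_eq (permutations (m :: s))
    [seq uv.1 ++ m :: uv.2 | p <- splits s,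
       uv <- [seq (u, v) | u <- permutations p.1, v <- permutations p.2]].
Proof.
move=> ums; have /andP[ms us] := ums.
have mem_uv p u v : p \in splits s ->
    (u, v) \in [seq (u, v) | u <- permutations p.1, v <- permutations p.2] ->
    perm_eq u p.1 /\ perm_eq v p.2.
  by move=> ps /allpairsP[[u' v'] /= [+ + [-> ->]]]; rewrite !mem_permutations.
have m_notin p u : p \in splits s -> perm_eq u p.1 -> m \notin u.
  move=> ps up; apply: contra ms; rewrite (perm_mem up) => mp.
  by rewrite -(perm_mem (splits_perm _ _ ps)) mem_cat mp.
apply: uniq_perm; first exact: permutations_uniq.
  apply: allpairs_uniq_dep; first exact: splits_uniq.
    move=> p _; apply: allpairs_uniq; try exact: permutations_uniq.
    by move=> [? ?] [? ?].
  move=> _ _ /allpairsPdep[p [[u v] [ps uvp ->]]]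
    /allpairsPdep[p' [[u' v'] [ps' uvp' ->]]] /= e.
  have [up vp] := mem_uv _ _ _ ps uvp; have [up' vp'] := mem_uv _ _ _ ps' uvp'.
  have [uu' vv'] := cat_cons_inj _ _ _ _ _ (m_notin _ _ ps up) (m_notin _ _ ps' up') e.
  (* The common word [u] fixes the letters of both first parts, hence the split. *)
  suff -> : p = p' by rewrite uu' vv'.
  rewrite (splits_filterE _ _ us ps) (splits_filterE _ _ us ps').
  have pp' : p.1 =i p'.1 by move=> x; rewrite -(perm_mem up) uu' (perm_mem up').
  by congr (_, _); apply: eq_filter => x /=; rewrite pp'.
move=> t; rewrite mem_permutations; apply/idP/allpairsPdep => [tms|].
  have mt : m \in t by rewrite (perm_mem tms) mem_head.
  case/splitPr: mt tms => u v tms.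
  have uvs : perm_eq (u ++ v) s.
    by rewrite -(perm_cons m) -(permPr tms) perm_sym perm_catC /= perm_cons perm_catC.
  have uuv : uniq (u ++ v) by rewrite (perm_uniq uvs).
  (* The split lists the letters of [u], and the remaining ones, in the order of [s]. *)
  exists (filter (mem u) s, filter (predC (mem u)) s), (u, v).
  split=> //; first exact: mem_splits_filter.
  apply/allpairsP; exists (u, v); split=> //=; rewrite mem_permutations.
    apply: uniq_perm; rewrite ?filter_uniq //.
      by move: uuv; rewrite cat_uniq => /andP[].
    move=> x; rewrite mem_filter -(perm_mem uvs) mem_cat /=.
    by case: (x \in u).
  apply: uniq_perm; rewrite ?filter_uniq //.
    by move: uuv; rewrite cat_uniq => /and3P[].
  move=> x; rewrite mem_filter -(perm_mem uvs) mem_cat /=.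
  case: (boolP (x \in u)) => //= xu; apply/negbTE.
  by move: uuv; rewrite uniq_catC cat_uniq => /and3P[_ /hasPn/(_ _ xu)].
move=> [p [[u v] [ps uvp ->]]] /=; have [up vp] := mem_uv _ _ _ ps uvp.
rewrite perm_catC /= perm_cons perm_catC -(permPr (splits_perm _ _ ps)).
exact: perm_cat.
Qed.

End WordStatistics.

Lemma gtn_trans : transitive gtn.
Proof. by move=> n m p /= nm pn; apply: ltn_trans pn nm. Qed.

(** * Gaussian binomial coefficients as inversion sums *)

Section QAnalogues.
Variables (K : fieldType) (q1 q2 : K).
Hypothesis q_neq0 : forall m : nat, (0 < m)%N -> qint q1 q2 m != 0.
Local Notation qint := (qint q1 q2).
Local Notation qfact := (qfact q1 q2).
Local Notation qbinom := (qbinom q1 q2).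

Lemma qint0 : qint 0 = 0.
Proof. by rewrite /qint big_ord0. Qed.

(** The first [b] terms of the sum share the factor [q1 ^+ a], the last [a] terms share
    [q2 ^+ b]. *)
Lemma qintD a b : qint (a + b) = q2 ^+ b * qint a + q1 ^+ a * qint b.
Proof.
rewrite addnC /Defs.qint big_split_ord /= addrC !mulr_sumr.
congr (_ + _); apply: eq_bigr => i _; have := ltn_ord i => ilt.
  by rewrite exprD mulrCA; congr (_ * (q1 ^+ _ * _)); lia.
by rewrite mulrA -exprD; congr (q1 ^+ _ * _); lia.
Qed.

Lemma qfact0 : qfact 0 = 1.
Proof. by rewrite /qfact big_geq. Qed.

Lemma qfactS n : qfact n.+1 = qfact n * qint n.+1.
Proof. by rewrite /qfact big_nat_recr. Qed.

Lemma qfact_neq0 n : qfact n != 0.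
Proof. by elim: n => [|n IH]; rewrite ?qfact0 ?oner_neq0 // qfactS mulf_neq0 ?q_neq0. Qed.

(* Summing Pascal's rule over [k] absorbs its boundary cases, where [qbinom n k]
   with [n < k] takes a nonzero junk value. *)
Lemma sum_qbinomS n (g : nat -> nat -> K) :
  \sum_(k < n.+2) qbinom n.+1 k * g k (n.+1 - k)%N =
  \sum_(k < n.+1) qbinom n k *
     (q2 ^+ (n - k) * g k.+1 (n - k)%N + q1 ^+ k * g k (n - k).+1).
Proof.
(* The term on the left without its factor [qint n.+1], which [qintD] splits at [k]. *)
pose c k := qfact n / (qfact k * qfact (n.+1 - k)) * g k (n.+1 - k)%N.
transitivity (\sum_(k < n.+2) q2 ^+ (n.+1 - k) * qint k * c k
              + \sum_(k < n.+2) q1 ^+ k * qint (n.+1 - k) * c k).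
  rewrite -big_split; apply: eq_bigr => k _ /=.
  rewrite -mulrDl -qintD subnKC ?(leq_ord k) // /c /Defs.qbinom qfactS.
  by rewrite !mulrA (mulrC (qint _)).
(* The factor [qint 0] kills [k = 0] in the first sum and [k = n.+1] in the second; shifting the
   first aligns them. *)
rewrite big_ord_recl qint0 mulr0 mul0r add0r.
rewrite [X in _ + X]big_ord_recr /= subnn qint0 mulr0 mul0r addr0 -big_split /=.
apply: eq_bigr => k _ /=; rewrite mulrDr /bump /= add1n subSS.
have kn : (k <= n)%N by rewrite leq_ord.
rewrite subSn // /c subSS subSn // /Defs.qbinom !qfactS.
have := qfact_neq0 k; have := qfact_neq0 (n - k).
have := q_neq0 k.+1 isT; have := q_neq0 (n - k).+1 isT.
by move=> *; congr (_ + _); field; apply/and3P; split.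
Qed.

(* Deleting the largest entry of [s] from whichever part of the split contains
   it turns the inversion weight into Pascal's rule. *)
Lemma sum_splits (g : nat -> nat -> K) (s : seq nat) : sorted gtn s ->
  \sum_(p <- splits s) q1 ^+ ncross_lt p.1 p.2 * q2 ^+ ncross_lt p.2 p.1
                         * g (size p.1) (size p.2)
  = \sum_(k < (size s).+1) qbinom (size s) k * g k (size s - k)%N.
Proof.
elim: s g => [|x s IH] g ss.
  rewrite /= big_seq1 big_ord1 /ncross_lt !big_nil /Defs.qbinom qfact0.
  by rewrite !mulr1 invr1 !mul1r.
have sx : all (gtn x) s by apply: order_path_min gtn_trans ss.
rewrite /= sum_qbinomS.
(* The new weight collects both placements of the largest letter [x]: it forms inversions with the
   whole second part, or non-inversions with the whole first part. *)
rewrite -(IH (fun a b => q2 ^+ b * g a.+1 b + q1 ^+ a * g a b.+1) (path_sorted ss)).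
rewrite big_cat /= !big_map -big_split /=; apply: eq_big_seq => p ps /=.
have [/mem_subseq s1 /mem_subseq s2] := splits_subseq _ _ ps.
have px1 : all (gtn x) p.1 by apply/allP => y /s1; apply: (allP sx).
have px2 : all (gtn x) p.2 by apply/allP => y /s2; apply: (allP sx).
rewrite !ncross_lt_consl // !ncross_lt_consr // !exprD.
ring.
Qed.

End QAnalogues.

(** * Permutations in one-line notation *)

Section PermutationWords.

Definition word_of {n} (s : 'S_n) : seq nat := [seq val (s i) | i <- enum 'I_n].

Lemma nth_word_of n (s : 'S_n) (i : 'I_n) : nth 0%N (word_of s) i = s i.
Proof. by rewrite (nth_map i) ?size_enum_ord // nth_ord_enum. Qed.

Lemma size_word_of n (s : 'S_n) : size (word_of s) = n.
Proof. by rewrite size_map size_enum_ord. Qed.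

(** The reference word is decreasing, so that its head is the maximum at which words are cut. *)
Lemma word_of_perm n (s : 'S_n) : perm_eq (word_of s) (rev (iota 0 n)).
Proof.
rewrite perm_sym perm_rev -val_enum_ord /word_of (map_comp val s) perm_map //.
rewrite perm_sym uniq_perm ?(map_inj_uniq perm_inj) ?enum_uniq //= => i.
by rewrite mem_enum; apply/mapP; exists ((s^-1)%g i); rewrite ?mem_enum ?permKV.
Qed.

Lemma word_of_inj n : injective (@word_of n).
Proof.
move=> s s' e; apply/permP => i; apply: val_inj.
by rewrite /= -!nth_word_of e.
Qed.

Lemma below_between_word_of n (s : 'S_n) (i j : 'I_n) (h : nat) :
  below_between (word_of s) i j h
    = ~~ [exists l : 'I_n, (i < l < j)%N && (h < s l)%N].
Proof.
rewrite negb_exists; apply/below_betweenP/forallP => H l.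
  by rewrite negb_and -leqNgt -nth_word_of -implybE; apply/implyP/H.
move=> /andP[il lj]; have := H (Ordinal (ltn_trans lj (ltn_ord j))).
by rewrite il lj /= -leqNgt -nth_word_of.
Qed.

Lemma card_pairs (n : nat) (P : pred ('I_n * 'I_n)) :
  #|[set x | P x]| = (\sum_(i < n) \sum_(j < n) P (i, j))%N.
Proof.
rewrite cardsE -sum1_card big_mkcond pair_bigA /=.
by apply: eq_bigr => -[i j] _; rewrite unfold_in; case: (P _).
Qed.

Lemma card_triples (n : nat) (P : pred ('I_n * 'I_n * 'I_n)) :
  #|[set x | P x]| = (\sum_(i < n) \sum_(j < n) \sum_(k < n) P (i, j, k))%N.
Proof.
rewrite cardsE -sum1_card big_mkcond pair_bigA pair_bigA /=.
by apply: eq_bigr => -[[i j] k] _; rewrite unfold_in; case: (P _).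
Qed.

Lemma word_S1_of n (s : 'S_n) : word_S1 (word_of s) = S1 s.
Proof.
rewrite /S1 card_pairs /word_S1 size_word_of.
by do 2!apply: eq_bigr => ? _; rewrite /occ12 !nth_word_of below_between_word_of.
Qed.

Lemma word_S2_of n (s : 'S_n) : word_S2 (word_of s) = S2 s.
Proof.
rewrite /S2 card_pairs /word_S2 size_word_of.
by do 2!apply: eq_bigr => ? _; rewrite /occ21 !nth_word_of below_between_word_of.
Qed.

Lemma no_above_skip n (s : 'S_n) (i j k : 'I_n) :
  [exists l : 'I_n, [&& (i < l < k)%N, l != j & (s j < s l)%N]]
    = [exists l : 'I_n, (i < l < k)%N && (s j < s l)%N].
Proof.
apply: eq_existsb => l; case: eqP => [->|//].
by rewrite ltnn !andbF.
Qed.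

Lemma word_T1_of n (s : 'S_n) : word_T1 (word_of s) = T1 s.
Proof.
rewrite /T1 card_triples /word_T1 size_word_of; do 3!apply: eq_bigr => ? _.
by rewrite /occ132 !nth_word_of below_between_word_of no_above_skip.
Qed.

Lemma word_T2_of n (s : 'S_n) : word_T2 (word_of s) = T2 s.
Proof.
rewrite /T2 card_triples /word_T2 size_word_of; do 3!apply: eq_bigr => ? _.
by rewrite /occ231 !nth_word_of below_between_word_of no_above_skip.
Qed.

Lemma rev_iotaS n : rev (iota 0 n.+1) = n :: rev (iota 0 n).
Proof. by rewrite -addn1 iotaD rev_cat. Qed.

End PermutationWords.

(** * The recurrence *)

Section Recurrence.
Variables (K : fieldType) (p1 p2 q1 q2 : K).
Hypothesis q_neq0 : forall m : nat, (0 < m)%N -> qint q1 q2 m != 0.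
Local Notation F := (meshF p1 p2 q1 q2).

Definition word_weight (t : seq nat) : K :=
  p1 ^+ word_S1 t * p2 ^+ word_S2 t * q1 ^+ word_T1 t * q2 ^+ word_T2 t.

Definition perm_weight (s : seq nat) : K :=
  \sum_(t <- permutations s) word_weight t.

(** [word_of] is injective into the arrangements of the reference word, and both sides have [n!]
    elements. *)
Lemma meshF_perm_weight n : F n = perm_weight (rev (iota 0 n)).
Proof.
have us : uniq (rev (iota 0 n)) by rewrite rev_uniq iota_uniq.
have e : perm_eq [seq word_of s | s : 'S_n] (permutations (rev (iota 0 n))).
  have uw : uniq [seq word_of s | s : 'S_n].
    by rewrite map_inj_uniq ?enum_uniq //; apply: word_of_inj.
  apply: uniq_perm; rewrite ?permutations_uniq //.
  have sub : {subset [seq word_of s | s : 'S_n] <= permutations (rev (iota 0 n))}.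
    by move=> _ /mapP[s _ ->]; rewrite mem_permutations word_of_perm.
  apply: (uniq_min_size uw sub _).2.
  rewrite size_permutations // size_rev size_iota size_map -cardE.
  by rewrite card_Sn.
rewrite /perm_weight -(perm_big _ e) big_image /meshF.
apply: eq_bigr => s _.
by rewrite /word_weight word_S1_of word_S2_of word_T1_of word_T2_of.
Qed.

(** Cutting at [m] makes the statistics additive, and the cross terms depend only on the split, so
    the sum over arrangements factors. *)
Lemma perm_weight_cons m s : sorted gtn (m :: s) ->
  perm_weight (m :: s) =
  \sum_(p <- splits s) q1 ^+ ncross_lt p.1 p.2 * q2 ^+ ncross_lt p.2 p.1
    * (p1 ^+ size p.1 * p2 ^+ size p.2 * perm_weight p.1 * perm_weight p.2).
Proof.
move=> ss; have ums : uniq (m :: s).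
  by apply: sorted_uniq ss => [|a]; [apply: gtn_trans|rewrite /= ltnn].
have sm : all (gtn m) s by apply: order_path_min gtn_trans ss.
rewrite /perm_weight (perm_big _ (permutations_cons _ _ ums)) big_allpairs_dep.
apply: eq_big_seq => p ps; rewrite big_allpairs.
rewrite -!mulrA [X in _ * (_ * (_ * (_ * X)))]big_distrlr /= !big_distrr.
have [/mem_subseq s1 /mem_subseq s2] := splits_subseq _ _ ps.
apply: eq_big_seq => u; rewrite mem_permutations => up; rewrite !big_distrr.
apply: eq_big_seq => v; rewrite mem_permutations => vp /=.
have ltu x : x \in u -> (x < m)%N by rewrite (perm_mem up) => /s1; apply: (allP sm).
have ltv x : x \in v -> (x < m)%N by rewrite (perm_mem vp) => /s2; apply: (allP sm).
rewrite /word_weight word_S1_max // word_S2_max // word_T1_max // word_T2_max //.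
rewrite (ncross_lt_perm _ _ _ _ up vp) (ncross_lt_perm _ _ _ _ vp up).
rewrite (perm_size up) (perm_size vp) !exprD.
ring.
Qed.

(** Independence of the letters is a hypothesis here, so that the lemma serves both inside the
    induction proving it and afterwards. *)
Lemma perm_weight_recurrence m s :
  (forall s', sorted gtn s' -> (size s' <= size s)%N -> perm_weight s' = F (size s')) ->
  sorted gtn (m :: s) ->
  perm_weight (m :: s) =
  \sum_(k < (size s).+1) qbinom q1 q2 (size s) k * p1 ^+ k * p2 ^+ (size s - k)
                         * F k * F (size s - k).
Proof.
move=> IH ss; rewrite perm_weight_cons //.
pose g a b := p1 ^+ a * p2 ^+ b * F a * F b.
transitivity (\sum_(k < (size s).+1) qbinom q1 q2 (size s) k * g k (size s - k)%N); last first.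
  by apply: eq_bigr => k _; rewrite /g !mulrA.
rewrite -(sum_splits _ _ _ q_neq0 _ _ (path_sorted ss)); apply: eq_big_seq => p ps.
have [s1 s2] := splits_subseq _ _ ps.
by rewrite !IH ?size_subseq //; apply: (subseq_sorted gtn_trans _ (path_sorted ss)).
Qed.

Lemma perm_weight_size s : sorted gtn s -> perm_weight s = F (size s).
Proof.
move: {2}(size s) (leqnn (size s)) => n; elim: n s => [|n IH] [|m s] //= sn ss.
- by rewrite meshF_perm_weight.
- by rewrite meshF_perm_weight.
have IHs s' : sorted gtn s' -> (size s' <= size s)%N -> perm_weight s' = F (size s').
  by move=> ss' s's; apply: IH => //; apply: leq_trans s's _.
rewrite perm_weight_recurrence //.
(* The reference word of the same size obeys the same recurrence, whose right side sees only the
   size. *)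
rewrite meshF_perm_weight rev_iotaS perm_weight_recurrence ?size_rev ?size_iota //.
by rewrite -rev_iotaS rev_sorted iota_ltn_sorted.
Qed.

Lemma meshFS n :
  F n.+1 = \sum_(k < n.+1) qbinom q1 q2 n k * p1 ^+ k * p2 ^+ (n - k)
                             * F k * F (n - k).
Proof.
rewrite meshF_perm_weight rev_iotaS perm_weight_recurrence ?size_rev ?size_iota //.
  by move=> s' ss' _; apply: perm_weight_size.
by rewrite -rev_iotaS rev_sorted iota_ltn_sorted.
Qed.

End Recurrence.

(** * The functional equation *)

Lemma fps_mul_cX0 (K : fieldType) (a b : K) (h : fps K) :
  fps_mul (fps_sub (fps_cX a) (fps_cX b)) h 0%N = 0.
Proof. by rewrite /fps_mul big_ord1 /fps_sub /fps_cX /= subr0 mul0r. Qed.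

Lemma fps_mul_cXS (K : fieldType) (a b : K) (h : fps K) n :
  fps_mul (fps_sub (fps_cX a) (fps_cX b)) h n.+1 = (a - b) * h n.
Proof.
rewrite /fps_mul 2!big_ord_recl big1 /fps_sub /fps_cX /= => [|i _].
  by rewrite subr0 mul0r add0r addr0 /bump /= subSS subn0.
by rewrite subr0 mul0r.
Qed.

Theorem mainTheorem8 (K : fieldType) (p1 p2 q1 q2 : K)
    (q_neq0 : forall m : nat, (0 < m)%N -> qint q1 q2 m != 0) :
  (forall n : nat,
     meshF p1 p2 q1 q2 n.+1 =
       \sum_(k < n.+1) qbinom q1 q2 n k * p1 ^+ k * p2 ^+ (n - k)
                         * meshF p1 p2 q1 q2 k * meshF p1 p2 q1 q2 (n - k))
  /\ (q1 != q2 ->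
      qderiv q1 q2 (meshFseries p1 p2 q1 q2) =
        fps_mul (fps_dilate p1 (meshFseries p1 p2 q1 q2))
                (fps_dilate p2 (meshFseries p1 p2 q1 q2))).
Proof.
split=> [n|q12]; first exact: meshFS.
(* By uniqueness of the quotient, it is enough to multiply by the denominator and compare
   coefficients. *)
apply/esym/qderivP => //; apply/funext => -[|n].
  by rewrite fps_mul_cX0 /fps_sub /fps_dilate !expr0 subrr.
(* The difference of powers is [q1 - q2] times [qint q1 q2 n.+1], which cancels the last factor of
   [qfact q1 q2 n.+1]. *)
rewrite fps_mul_cXS /fps_sub /fps_dilate -mulrBl subrXX.
rewrite -/(qint q1 q2 n.+1) /meshFseries qfactS meshFS // -mulrA; congr (_ * _).
have qn := q_neq0 n.+1 isT; have fn := qfact_neq0 _ _ _ q_neq0 n.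
rewrite invfM mulrCA (mulrA (qint _ _ _)) (mulrC (qint _ _ _)) mulfK //.
(* Dividing the recurrence by [qfact q1 q2 n] leaves the Cauchy product, term by term. *)
rewrite /fps_mul mulr_suml; apply: eq_bigr => k _; rewrite /qbinom.
have fk := qfact_neq0 _ _ _ q_neq0 k; have fnk := qfact_neq0 _ _ _ q_neq0 (n - k).
by field; apply/and3P; split.
Qed.
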